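(* Every upcycle has the partial subwords distribution property. That is, if $u$ is an upcycle for $A^n$ and $a=|A|$, then for every $k\in\{1,\dots,n\}$ and every $v\in A^k$, the expected multiplicity of $v$ in $u$ satisfies $E(u,v)=|u|/a^k$.
   Context: Let $A$ be an alphabet with $a=|A|\ge 2$ letters and $\diamond\notin A$ a wildcard symbol (''diamond''). A partial word is a finite sequence over $A\cup\{\diamond\}$; a cyclic partial word $u=(u_1\cdots u_N)$ is cyclically ordered, with indices taken modulo $N$, and $|u|=N$. A partial word $x$ covers a word $y$ of the same length if for each $i$ either $x_i=\diamond$ or $x_i=y_i$. For $n\ge 1$, an upcycle for $A^n$ is a cyclic partial word $u=(u_1\cdots u_N)$ such that for each word $y\in A^n$ there is exactly one position $i\in\{1,\dots,N\}$ such that the window $u_i\cdots u_{i+n-1}$ covers $y$. Expected multiplicity: for a cyclic partial word $u$ and a word $w$ over $A$, let $S_{|w|}(u)$ be the multiset of the $|u|$ windows $u_iu_{i+1}\cdots u_{i+|w|-1}$, $1\le i\le |u|$, and for $q\ge 0$ let $\mathcal{C}(u,w,q)$ be the sub-multiset of those windows that cover $w$ and contain exactly $q$ diamonds. Then $E(u,w)=\sum_{q\ge 0}|\mathcal{C}(u,w,q)|/a^q$. A cyclic partial word $u$ has the partial subwords distribution property with respect to $n$ if for every $k\in\{1,\dots,n\}$ and $v\in A^k$ one has $E(u,v)=|u|/a^k$; for an upcycle for $A^n$ this is meant with respect to that $n$. *)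

(* Defs.v *)
From mathcomp Require Import all_boot all_order all_algebra.

Set Implicit Arguments.
Unset Strict Implicit.
Unset Printing Implicit Defensive.

Import GRing.Theory.
Local Open Scope ring_scope.

Section PartialWords.
Variable A : finType.

(* A partial letter is an [option A], with [None] for the diamond. A cyclic
   partial word is given by a representative [u : seq (option A)], read
   cyclically; positions are numbered from 0. *)
Definition partial_letter := option A.
Definition cyclic_partial_word := seq partial_letter.

Definition covers (n : nat) (x : n.-tuple partial_letter) (y : n.-tuple A)
  : bool :=
  [forall i : 'I_n, (tnth x i == None) || (tnth x i == Some (tnth y i))].

(* The indices wrap around as often as necessary, so [n] may exceed [size u]. *)
Definition window (u : cyclic_partial_word) (n i : nat)
  : n.-tuple partial_letter :=
  [tuple nth None u ((i + j) %% size u) | j < n].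

Definition upcycle (n : nat) (u : cyclic_partial_word) : Prop :=
  forall y : n.-tuple A,
    exists! i : 'I_(size u), covers (window u n i) y.

(* Multisets of windows are represented by lists with repetitions. *)
Definition windows (u : cyclic_partial_word) (k : nat)
  : seq (k.-tuple partial_letter) :=
  [seq window u k i | i <- iota 0 (size u)].

Definition diamonds (k : nat) (x : k.-tuple partial_letter) : nat :=
  count_mem None x.

Definition covering_windows (u : cyclic_partial_word) (k : nat)
    (w : k.-tuple A) (q : nat) : seq (k.-tuple partial_letter) :=
  [seq x <- windows u k | covers x w && (diamonds x == q)].

Lemma covering_windows_eq0 (u : cyclic_partial_word) (k : nat)
    (w : k.-tuple A) (q : nat) : (k < q)%N -> covering_windows u w q = [::].
Proof.
move=> lt_kq; apply/eqP; rewrite -size_eq0 size_filter -leqn0 leqNgt -has_count.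
apply/hasPn => x _; rewrite negb_and; apply/orP; right.
by rewrite neq_ltn (leq_ltn_trans (count_size _ _)) // size_tuple.
Qed.

(* The sum over all [q >= 0] stops at [q = k], because its later terms vanish
   by [covering_windows_eq0]. *)
Definition expected_multiplicity (u : cyclic_partial_word) (k : nat)
    (w : k.-tuple A) : rat :=
  \sum_(0 <= q < k.+1) (size (covering_windows u w q))%:R / #|A|%:R ^+ q.

Definition partial_subwords_distribution (n : nat) (u : cyclic_partial_word)
  : Prop :=
  forall k : nat, (1 <= k <= n)%N -> forall v : k.-tuple A,
    expected_multiplicity u v = (size u)%:R / #|A|%:R ^+ k.

End PartialWords.

(* Main.v *)
Require Import Defs.
From mathcomp Require Import all_boot all_order all_algebra.

(** Counting the right and the left one-letter extensions of a word of length
    [n - 1] covered by a window shows that in an upcycle position [i] carries a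
    diamond iff position [i + n] does, so all windows of length [n] have the
    same number [d] of diamonds and [E(u, w) = a^-d] for [w] in [A^n]. Moreover
    [E(u, v)] is the sum of [E(u, vc)] over the letters [c], so
    [E(u, v) = a^(n - k - d)] for [v] in [A^k]; at [k = 0] this reads
    [|u| = a^(n - d)]. *)

Set Implicit Arguments.
Unset Strict Implicit.
Unset Printing Implicit Defensive.

Import GRing.Theory.

Lemma sum_periodic_shift (N : nat) (F : nat -> nat) :
  F N = F 0 -> \sum_(i < N) F i.+1 = \sum_(i < N) F i.
Proof.
case: N => [|N] FN; first by rewrite !big_ord0.
by rewrite big_ord_recr big_ord_recl /= FN addnC.
Qed.

(* The [i]-th term already exhausts the first sum, so [p] vanishes off [i], and
   the second sum reduces to its [i]-th term. *)
Lemma weight_transfer (N a : nat) (p : 'I_N -> nat) (g h : 'I_N -> bool)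
    (i : 'I_N) :
  1 < a -> 0 < p i ->
  \sum_(j < N) (if g j then a else 1) * p j = a ->
  \sum_(j < N) (if h j then a else 1) * p j = a ->
  g i -> h i.
Proof.
move=> a1 pi sg sh gi; case: (boolP (h i)) => // /negPf hi.
have a0 : 0 < a by apply: ltnW.
move: sg; rewrite (bigD1 i) //= gi => sg.
have pi1 : p i = 1.
  have : a * p i <= a by rewrite -[leqRHS]sg leq_addr.
  by rewrite -[leqRHS]muln1 leq_pmul2l // => le_p; apply/eqP; rewrite eqn_leq le_p.
have s0 : \sum_(j < N | j != i) (if g j then a else 1) * p j = 0.
  by apply/eqP; move/eqP: sg; rewrite pi1 muln1 -[eqbRHS]addn0 eqn_add2l.
have p0 j : j != i -> p j = 0.
  move=> ji; move/eqP: s0; rewrite sum_nat_eq0 => /forallP /(_ j).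
  rewrite ji muln_eq0 => /orP[|/eqP //].
  by case: ifP => _ //; rewrite eqn0Ngt a0.
move: sh; rewrite (bigD1 i) //= hi pi1 big1 => [ea|j ji]; last by rewrite p0 ?muln0.
by rewrite -ea in a1.
Qed.

Section Periodic.
Variable A : finType.
Implicit Types (U : nat -> option A) (w : nat -> A).

Definition fits (o : option A) (c : A) : bool := (o == None) || (o == Some c).

Definition word_cons (c : A) w (j : nat) : A := if j is j'.+1 then w j' else c.

Definition word_set w (k : nat) (c : A) (j : nat) : A :=
  if j == k then c else w j.

(** Words are infinite sequences of which only the first [k] letters are read, so changing the
    length needs no casts. As a product in [nat], the covering test factors letter by letter under
    sums. *)
Definition matches U (k i : nat) w : nat := \prod_(j < k) fits (U (i + j)) (w j).

Definition ndiamonds U (k i : nat) : nat := \sum_(j < k) (U (i + j) == None).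

Lemma sum_fits (o : option A) :
  \sum_(c : A) fits o c = if o == None then #|A| else 1.
Proof.
case: o => [b|]; last by rewrite sum1_card.
rewrite (bigD1 b) //= /fits eqxx big1 // => c cb.
by rewrite /= eqE /= eq_sym (negPf cb).
Qed.

Lemma matches_recr U k i w :
  matches U k.+1 i w = matches U k i w * fits (U (i + k)) (w k).
Proof. by rewrite /matches big_ord_recr. Qed.

Lemma matches_cons U k i c w :
  matches U k.+1 i (word_cons c w) = fits (U i) c * matches U k i.+1 w.
Proof.
rewrite /matches big_ord_recl addn0; congr (_ * _).
by apply: eq_bigr => j _; rewrite /bump /= addnS.
Qed.

Lemma matches_set U k i w c : matches U k i (word_set w k c) = matches U k i w.
Proof. by apply: eq_bigr => j _; rewrite /word_set ltn_eqF. Qed.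

Lemma matchesE U k i w :
  matches U k i w = [forall j : 'I_k, fits (U (i + j)) (w j)] :> nat.
Proof.
rewrite /matches; case: (boolP [forall j, _]) => [/forallP fit|].
  by rewrite big1 // => j _; rewrite fit.
by rewrite negb_forall => /existsP[j /negPf nfit]; rewrite (bigD1 j) //= nfit.
Qed.

(** Moving the window one step drops position [i] and gains position [i + n]. *)
Lemma ndiamonds_shift U n i :
  (U i == None) = (U (i + n) == None) -> ndiamonds U n i.+1 = ndiamonds U n i.
Proof.
case: n => [|n] Ui; first by rewrite /ndiamonds !big_ord0.
rewrite /ndiamonds big_ord_recr [RHS]big_ord_recl /= addSnnS addn0 Ui addnC.
by congr (_ + _); apply: eq_bigr => j _; rewrite /bump /= addSnnS.
Qed.

(** * Recurrence of diamonds in an upcycle for words of length [n.+1] *)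

Section Diamondicity.
Variables (N n : nat) (U : nat -> option A).
Hypothesis (hA : 1 < #|A|).
Hypothesis U_periodic : forall i, U (i + N) = U i.
Hypothesis U_universal : forall w, \sum_(i < N) matches U n.+1 i w = 1.

Lemma matches_periodic k w : matches U k N w = matches U k 0 w.
Proof. by apply: eq_bigr => j _; rewrite addnC U_periodic. Qed.

(** Double count of the pairs (letter [c], position covering [cw]): each [c] has one position, and
    [sum_fits] counts the letters that position [i] admits. *)
Lemma sum_left_extensions w :
  \sum_(i < N) (if U i == None then #|A| else 1) * matches U n i.+1 w = #|A|.
Proof.
rewrite -[RHS]sum1_card.
under [RHS]eq_bigr => c _ do rewrite -(U_universal (word_cons c w)).
rewrite exchange_big; apply: eq_bigr => i _ /=.
by rewrite -sum_fits big_distrl; apply: eq_bigr => c _; rewrite matches_cons.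
Qed.

(** The same count for the words [wc], reindexed cyclically by one so that both sums carry the
    factor [matches U n i.+1 w]. *)
Lemma sum_right_extensions w :
  \sum_(i < N) (if U (i + n.+1) == None then #|A| else 1) * matches U n i.+1 w
  = #|A|.
Proof.
pose F i := (if U (i + n) == None then #|A| else 1) * matches U n i w.
have FN : F N = F 0 by rewrite /F matches_periodic addnC U_periodic.
under eq_bigr => i _ do rewrite -addSnnS.
rewrite (sum_periodic_shift FN) -[RHS]sum1_card.
under [RHS]eq_bigr => c _ do rewrite -(U_universal (word_set w n c)).
rewrite exchange_big; apply: eq_bigr => i _ /=.
rewrite /F -sum_fits big_distrl; apply: eq_bigr => c _.
by rewrite matches_recr matches_set /word_set eqxx mulnC.
Qed.

Lemma diamond_periodic (i : 'I_N) : (U i == None) = (U (i + n.+1) == None).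
Proof.
have /card_gt0P [a0 _] : 0 < #|A| by apply: ltnW.
(* A word covered by the window at [i.+1], with diamonds filled by [a0]; it makes the weight at [i]
   positive, as [weight_transfer] requires. *)
pose w j := odflt a0 (U (i.+1 + j)).
have wi : 0 < matches U n i.+1 w.
  rewrite matchesE lt0b; apply/forallP => j; rewrite /w /fits.
  by case: (U _) => //= b; rewrite eqxx.
have [L R] := (sum_left_extensions w, sum_right_extensions w).
apply/idP/idP.
- exact: (@weight_transfer _ _ _ (fun j : 'I_N => U j == None)
            (fun j : 'I_N => U (j + n.+1) == None) i hA wi L R).
- exact: (@weight_transfer _ _ _ (fun j : 'I_N => U (j + n.+1) == None)
            (fun j : 'I_N => U j == None) i hA wi R L).
Qed.

Lemma ndiamonds_constant i : i <= N -> ndiamonds U n.+1 i = ndiamonds U n.+1 0.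
Proof.
elim: i => // i IHi ltiN.
by rewrite ndiamonds_shift ?IHi 1?ltnW // (diamond_periodic (Ordinal ltiN)).
Qed.

End Diamondicity.

Local Open Scope ring_scope.

(** * Expected multiplicities as sums over positions *)

Definition multiplicity U (N k : nat) w : rat :=
  \sum_(i < N) (matches U k i w)%:R / #|A|%:R ^+ ndiamonds U k i.

Lemma multiplicity0 U N w : multiplicity U N 0 w = N%:R.
Proof.
rewrite /multiplicity.
under eq_bigr => i _ do rewrite /matches /ndiamonds !big_ord0 expr0 divr1.
by rewrite sumr_const card_ord.
Qed.

(** If position [i + k] holds a diamond, all letters extend the match, each with weight divided by
    [#|A|]; otherwise exactly one does, with unchanged weight. *)
Lemma multiplicity_extend U N k w : (0 < #|A|)%N ->
  multiplicity U N k w = \sum_(c : A) multiplicity U N k.+1 (word_set w k c).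
Proof.
move=> hA; rewrite /multiplicity exchange_big; apply: eq_bigr => i _ /=.
have a0 : #|A|%:R != 0 :> rat by rewrite Num.Theory.pnatr_eq0 -lt0n.
rewrite -mulr_suml.
under eq_bigr => c _ do
  rewrite matches_recr matches_set /word_set eqxx natrM.
rewrite -mulr_sumr -natr_sum sum_fits.
rewrite [ndiamonds U k.+1 i]/ndiamonds big_ord_recr /= -/(ndiamonds U k i).
case: eqP => _; last by rewrite addn0 mulr1.
by rewrite addn1 exprSr invfM mulrACA divff // mulr1.
Qed.

Lemma multiplicity_downward U N C m k w : (0 < #|A|)%N ->
  (forall w', multiplicity U N (m + k) w' = C) ->
  multiplicity U N k w = C * #|A|%:R ^+ m.
Proof.
move=> hA; elim: m k w => [|m IHm] k w hC; first by rewrite mulr1 -(hC w).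
rewrite multiplicity_extend //.
under eq_bigr => c _ do rewrite (IHm k.+1) ?addnS //.
by rewrite sumr_const exprSr mulrA mulr_natr.
Qed.

Lemma multiplicity_uniform U N n k w :
  (1 < #|A|)%N -> (forall i, U (i + N)%N = U i) ->
  (forall w', \sum_(i < N) matches U n.+1 i w' = 1)%N -> (k <= n.+1)%N ->
  multiplicity U N k w = N%:R / #|A|%:R ^+ k.
Proof.
move=> hA perU uniU lekn; have hA0 : (0 < #|A|)%N by apply: ltnW.
have a0 : #|A|%:R != 0 :> rat by rewrite Num.Theory.pnatr_eq0 -lt0n.
pose C : rat := (#|A|%:R ^+ ndiamonds U n.+1 0)^-1.
have hC w' : multiplicity U N n.+1 w' = C.
  rewrite /multiplicity.
  under eq_bigr => i _ do
    rewrite (ndiamonds_constant hA perU uniU (ltnW (ltn_ord i))).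
  by rewrite -mulr_suml -natr_sum uniU mul1r.
(* With [N] read as the multiplicity of the empty word, both sides descend from the same constant
   [C] at length [n.+1]. *)
rewrite -(multiplicity0 U N w).
rewrite (multiplicity_downward (m := n.+1 - k) w hA0 (C := C)) => [|w']; last first.
  by rewrite subnK.
rewrite (multiplicity_downward (m := n.+1) w hA0 (C := C)) => [|w']; last first.
  by rewrite addn0.
by rewrite -[in RHS](subnK lekn) exprD mulrA mulfK // expf_neq0.
Qed.

(** * Transfer to cyclic partial words and tuples *)

Definition cyclic_letter (u : cyclic_partial_word A) (j : nat) : option A :=
  nth None u (j %% size u).

Lemma covers_window u k i (v : k.-tuple A) w :
  (forall j : 'I_k, w j = tnth v j) ->
  covers (window u k i) v = matches (cyclic_letter u) k i w :> nat.
Proof.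
move=> wv; rewrite matchesE; congr nat_of_bool.
by apply: eq_forallb => j; rewrite tnth_mktuple wv.
Qed.

Lemma diamonds_window u k i :
  diamonds (window u k i) = ndiamonds (cyclic_letter u) k i.
Proof.
rewrite /diamonds -sum1_count /= big_map big_enum_cond /= big_mkcond.
by apply: eq_bigr => j _; rewrite /cyclic_letter /=; case: eqP.
Qed.

(** After exchanging the sums, each position contributes only at the [q] equal to its number of
    diamonds. *)
Lemma expected_multiplicityE u k (v : k.-tuple A) w :
  (forall j : 'I_k, w j = tnth v j) ->
  expected_multiplicity u v = multiplicity (cyclic_letter u) (size u) k w.
Proof.
move=> wv; rewrite /expected_multiplicity /multiplicity.
have sz q : (size (covering_windows u v q))%:R = \sum_(i < size u)
    (covers (window u k i) v && (diamonds (window u k i) == q))%:R :> rat.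
  rewrite -natr_sum; congr (_%:R); rewrite size_filter count_map -sumn_count.
  by rewrite sumnE big_map -[X in iota 0 X]subn0 big_mkord.
under eq_bigr => q _ do rewrite sz mulr_suml.
rewrite exchange_big; apply: eq_bigr => i _ /=.
rewrite -(covers_window _ _ wv) -diamonds_window.
set d := diamonds _.
(* A window of length [k] has at most [k] diamonds, so the term [q = d] lies in the truncated
   range. *)
have dk : (d < k.+1)%N by rewrite ltnS -[leqRHS](size_tuple (window u k i)) count_size.
rewrite big_mkord (bigD1 (Ordinal dk)) //= eqxx andbT big1 ?addr0 // => q qd.
suff /negPf -> : d != q by rewrite andbF mul0r.
by apply: contraNneq qd => dq; apply/eqP/val_inj.
Qed.

Lemma upcycle_sum_matches n (u : cyclic_partial_word A) w : upcycle n u ->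
  (\sum_(i < size u) matches (cyclic_letter u) n i w = 1)%N.
Proof.
move=> /(_ [tuple w j | j < n]) [i [ci uniq_i]].
have E j : matches (cyclic_letter u) n j w
           = covers (window u n j) [tuple w l | l < n].
  by rewrite (@covers_window _ _ _ _ w) // => l; rewrite tnth_mktuple.
rewrite (bigD1 i) //= E ci big1 // => j ji; rewrite E.
by case: (boolP (covers _ _)) => // /uniq_i ij; rewrite ij eqxx in ji.
Qed.

End Periodic.

Theorem theorem7p7 (A : finType) (hA : 2 <= #|A|) (n : nat) (hn : 1 <= n)
    (u : cyclic_partial_word A) :
  upcycle n u -> partial_subwords_distribution n u.
Proof.
move=> up_u k /andP[_ lekn] v.
have /card_gt0P [a0 _] : 0 < #|A| by apply: ltnW.
(* The default [a0] only fills positions past the end of [v], which are never read at length [k]. *)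
rewrite (@expected_multiplicityE _ _ _ _ (nth a0 v)); last first.
  by move=> j; rewrite (tnth_nth a0).
case: n hn up_u lekn => // n _ up_u lekn.
apply: (@multiplicity_uniform _ _ _ n) => // [i|w].
  by rewrite /cyclic_letter modnDr.
exact: upcycle_sum_matches.
Qed.
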